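(* Let $p\in\mathbb{N}$ and suppose: (1) $\mathbf{f}_1,\dots,\mathbf{f}_p$ are non-zero elements of $\ell^2(\Lambda,\mathcal{M}_n)$ such that $\{\mathcal{D}_{2N\lambda}\mathbf{f}_j\}_{\lambda\in\Lambda,\,1\le j\le p}$ is a matrix-valued DFNS for $\ell^2(\Lambda,\mathcal{M}_n)$ with (lower and upper) frame bounds $a_0$ and $b_0$; (2) $\mathbf{g}_1,\dots,\mathbf{g}_p\in\ell^2(\Lambda,\mathcal{M}_n)$ and $\epsilon>0$ satisfy $\epsilon^2<\dfrac{a_0}{2^{p-1}(N+b_0)^2n^2}$ and, for every $j\in\{1,\dots,p\}$ and a.e. $x\in\Omega$, $\mathcal{F}(\mathbf{f}_j)(x)\neq 0$ and $$\frac{\left\|\mathcal{F}(\mathbf{g}_j)(x)-\mathcal{F}(\mathbf{f}_j)(x)\right\|_{\mathcal{M}_n}}{\left\|\mathcal{F}(\mathbf{f}_j)(x)\right\|_{\mathcal{M}_n}}\le\epsilon.$$ Then $\{\mathcal{D}_{2N\lambda}\mathbf{g}_j\}_{\lambda\in\Lambda,\,1\le j\le p}$ is also a matrix-valued DFNS for $\ell^2(\Lambda,\mathcal{M}_n)$, with lower frame bound $\big(\sqrt{a_0}-\sqrt{2^{p-1}\epsilon^2(N+b_0)^2n^2}\big)^2$ and upper frame bound $2^p\epsilon^2(N+b_0)^2n^2+2b_0$.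
   Context: Fix $n,N\in\mathbb{N}$ (positive integers) and an odd integer $r$ coprime to $N$ with $1\le r\le 2N-1$. Put $\Lambda=\{0,\frac{r}{N}\}+2\mathbb{Z}\subset\mathbb{R}$ and $\Omega=[0,\frac12)\cup[\frac N2,\frac{N+1}{2})$. $\mathcal{M}_n$ is the space of complex $n\times n$ matrices with norm $\|\mathbf{a}\|_{\mathcal{M}_n}=\big(\sum_{m,k=1}^n|a_{m,k}|^2\big)^{1/2}$. $\ell^2(\Lambda,\mathcal{M}_n)$ is the Hilbert space of maps $\mathbf{f}:\Lambda\to\mathcal{M}_n$ with $\sum_{\lambda\in\Lambda}\sum_{m,k=1}^n|f_{m,k}(\lambda)|^2<\infty$, with inner product $\langle\mathbf{f},\mathbf{g}\rangle=\sum_{\lambda\in\Lambda}\sum_{m,k=1}^n f_{m,k}(\lambda)\overline{g_{m,k}(\lambda)}$ and associated norm $\|\cdot\|_{\ell^2}$. $L^2(\Omega,\mathcal{M}_n)$ is the Hilbert space of $\mathcal{M}_n$-valued functions on $\Omega$ with entries in $L^2(\Omega)$ and inner product $\sum_{m,k}\int_\Omega F_{m,k}(x)\overline{G_{m,k}(x)}\,dx$. The Fourier transform $\mathcal{F}:\ell^2(\Lambda,\mathcal{M}_n)\to L^2(\Omega,\mathcal{M}_n)$ is defined entrywise by $\mathcal{F}(\mathbf{f})_{m,k}(x)=\sum_{\lambda\in\Lambda}f_{m,k}(\lambda)e^{2\pi i\lambda x}$ (convergence in $L^2(\Omega)$; $\{e^{2\pi i\lambda\cdot}\}_{\lambda\in\Lambda}$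 is a complete orthonormal system of $L^2(\Omega)$). For $\lambda\in\Lambda$, the displacement operator $\mathcal{D}_{2N\lambda}$ on $\ell^2(\Lambda,\mathcal{M}_n)$ is $(\mathcal{D}_{2N\lambda}\mathbf{f})(\lambda')=\mathbf{f}(\lambda'-2N\lambda)$, $\lambda'\in\Lambda$. For non-zero $\mathbf{f}_1,\dots,\mathbf{f}_p\in\ell^2(\Lambda,\mathcal{M}_n)$, the collection $\{\mathcal{D}_{2N\lambda}\mathbf{f}_j\}_{\lambda\in\Lambda,\,1\le j\le p}$ is a matrix-valued discrete frame of non-uniform shifts (matrix-valued DFNS) for $\ell^2(\Lambda,\mathcal{M}_n)$ with lower frame bound $a\in(0,\infty)$ and upper frame bound $b\in(0,\infty)$ if $a\|\mathbf{f}\|_{\ell^2}^2\le\sum_{j=1}^p\sum_{\lambda\in\Lambda}|\langle\mathbf{f},\mathcal{D}_{2N\lambda}\mathbf{f}_j\rangle|^2\le b\|\mathbf{f}\|_{\ell^2}^2$ for all $\mathbf{f}\in\ell^2(\Lambda,\mathcal{M}_n)$. (Frame bounds are not unique.) *)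

(* Defs.v *)
From HB Require Import structures.
From mathcomp Require Import all_boot all_order all_algebra.
From mathcomp Require Import complex finmap.
From mathcomp Require Import all_classical all_reals all_analysis.
From mathcomp.analysis.showcase Require summability.

Set Implicit Arguments.
Unset Strict Implicit.
Unset Printing Implicit Defensive.
Import Order.TTheory GRing.Theory Num.Theory.
Import numFieldNormedType.Exports.

Local Open Scope classical_set_scope.
Local Open Scope ring_scope.

Section Definitions.
Variable R : realType.

Definition Lambda (N r : nat) : set R :=
  [set a + 2 * k%:~R | a in [set 0; r%:R / N%:R] & k in [set: int]].

Definition Omega (N : nat) : set R :=
  `[0, 2^-1[%classic `|` `[N%:R / 2, (N%:R + 1) / 2[%classic.

Lemma Lambda_shift (N r : nat) (l l' : Lambda N r) :
  val l' - (2 * N)%:R * val l \in Lambda N r.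
Proof.
have even (x : R) : Lambda N r x -> exists z : int, (2 * N)%:R * x = 2 * z%:~R.
  case=> a /= a0r [k _ <-].
  have [m ->] : exists m : int, a = m%:~R / N%:R.
    case: a0r => ->; first by exists 0; rewrite mul0r.
    by exists r%:Z; rewrite pmulrn.
  have [->|N0] := eqVneq N 0%N; first by exists 0; rewrite muln0 mul0r mulr0.
  exists (m + N%:Z * (2 * k)); rewrite natrM -mulrA; congr (_ * _).
  rewrite mulrDr mulrC divfK ?pnatr_eq0// rmorphD rmorphM rmorphM/=.
  by rewrite -pmulrn.
have [z ->] := even _ (set_valP l).
case: (set_valP l') => a a0r [k _ /= E]; apply/mem_set.
exists a => //; exists (k - z) => //.
by rewrite -E rmorphB/= mulrBr addrA.
Qed.

Definition frob_norm (n : nat) (A : 'M[R[i]]_n) : R :=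
  Num.sqrt (\sum_(m < n) \sum_(k < n) Normc.normc (A m k) ^+ 2).

(* Sums of absolutely summable families, through the positive and negative
   parts; a junk value for other families. *)
Definition real_sum (I : choiceType) (u : I -> R) : R :=
  fine (\esum_(i in [set: I]) ((u ^\+) i)%:E)
  - fine (\esum_(i in [set: I]) ((u ^\-) i)%:E).

Definition complex_sum (I : choiceType) (u : I -> R[i]) : R[i] :=
  Complex (real_sum (fun i => complex.Re (u i)))
          (real_sum (fun i => complex.Im (u i))).

Section Sequences.
Variables n N r : nat.
Implicit Types f g : Lambda N r -> 'M[R[i]]_n.

Definition ell2 f : Prop :=
  (\esum_(l in [set: Lambda N r])
     (\sum_(m < n) \sum_(k < n) Normc.normc (f l m k) ^+ 2)%:E < +oo)%E.

Definition ell2_inner f g : R[i] :=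
  complex_sum (fun l : Lambda N r =>
    \sum_(m < n) \sum_(k < n) f l m k * conjc (g l m k)).

Definition ell2_norm f : R := Num.sqrt (complex.Re (ell2_inner f f)).

(* The operator D_{2Nl}. *)
Definition displacement (l : Lambda N r) f : Lambda N r -> 'M[R[i]]_n :=
  fun l' => f (SigSub (Lambda_shift l l')).

Definition DFNS (p : nat) (f : 'I_p -> Lambda N r -> 'M[R[i]]_n) (a b : R) :
    Prop :=
  [/\ forall j, ell2 (f j) /\ f j <> (fun=> 0),
      0 < a,
      0 < b &
      forall h, ell2 h ->
        ((a * ell2_norm h ^+ 2)%:E <=
         \sum_(j < p) \esum_(l in [set: Lambda N r])
           (Normc.normc (ell2_inner h (displacement l (f j))) ^+ 2)%:E <=
         (b * ell2_norm h ^+ 2)%:E)%E].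

Definition expi (t : R) : R[i] := Complex (cos t) (sin t).

Definition L2_Omega (F : R -> 'M[R[i]]_n) : Prop :=
  (forall m k,
     measurable_fun (Omega N) (fun x => complex.Re (F x m k)) /\
     measurable_fun (Omega N) (fun x => complex.Im (F x m k))) /\
  (\int[lebesgue_measure]_(x in Omega N) (frob_norm (F x) ^+ 2)%:E < +oo)%E.

(* F is a representative of the Fourier transform of f: the L2(Omega)-limit of
   the partial sums over finite subsets A of Lambda, along the directed set of
   all such A. It is determined by f up to almost everywhere equality. *)
Definition is_fourier f (F : R -> 'M[R[i]]_n) : Prop :=
  L2_Omega F /\
  (fun A : {fset Lambda N r} =>
     (\int[lebesgue_measure]_(x in Omega N)
        (frob_norm (F x - summability.partial_sum
           (fun l : Lambda N r => expi (2 * pi * val l * x) *: f l) A)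
         ^+ 2)%:E)%E) @ @summability.totally (Lambda N r) --> 0%E.

End Sequences.
End Definitions.

Arguments Lambda R N r : clear implicits.
Arguments Omega R N : clear implicits.

(* Main.v *)
Require Import Defs.
From mathcomp Require Import all_boot all_order all_algebra.
From mathcomp Require Import complex finmap.
From mathcomp Require Import all_classical all_reals all_analysis.
From mathcomp Require Import measurable_realfun ring lra.
From mathcomp.analysis.showcase Require summability.
Import Order.TTheory GRing.Theory Num.Theory.
Import numFieldNormedType.Exports.
Local Open Scope classical_set_scope.
Local Open Scope ring_scope.

(** Write d_j = g_j - f_j and let M be the number 2^(p-1) eps^2 (N + b0)^2 n^2.
    If the analysis coefficients of the shifts of the d_j satisfy
      sum_j sum_l |<h, D_l d_j>|^2 <= M |h|^2     with M < a0,
    then the triangle inequality for square-summable families, applied to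
    <h, D_l g_j> = <h, D_l f_j> + <h, D_l d_j>, gives the two frame bounds
    ([frame_bounds_perturbation]).  All the work is in that estimate.

    A family e is Bessel with bound b as soon as, and only if, its synthesis
    operator satisfies |sum_l c_l e_l|^2 <= b sum_l |c_l|^2 for finite sums
    ([synthesis_le_of_bessel] and [bessel_of_synthesis_le]).  Synthesis is what
    behaves well under the Fourier transform: sum_l c_l D_l f is carried to P F,
    where F is the transform of f and P is a scalar trigonometric polynomial
    that depends on the coefficients c only ([is_fourier_shift_sum]).  The same
    P serves f_j and d_j.  Hence |G_j - F_j| <= eps |F_j| almost everywhere
    implies |P (G_j - F_j)| <= eps |P F_j|, and Parseval's identity turns this
    into
      |sum_l c_l D_l d_j| <= eps |sum_l c_l D_l f_j|      ([shift_sum_le]).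
    The shifts of f_j have Bessel bound b0, so those of d_j have Bessel bound
    eps^2 b0 ([bessel_perturbation]).  Summing over j gives p eps^2 b0, and this
    is at most M because p <= 2^(p-1) and b0 <= (N + b0)^2.

    Parseval's identity ([parseval]) is the passage to the limit of its version
    for finite sums ([integral_trig_sum]), which is the orthonormality of the
    exponentials exp(2 pi i l x), l in Lambda, on Omega: up to a nonzero factor
    the integral of exp(2 pi i q x) over Omega is
      (1 + exp(pi i q N)) (exp(pi i q) - 1) / q,
    and a difference q of two points of Lambda is either an even integer or such
    that q N is an odd integer.

    Finally no g_j vanishes: otherwise d_j = - f_j, so |f_j| <= eps |f_j|, while
    eps < 1 because eps^2 b0 <= M < a0 <= b0. *)

Set Implicit Arguments.
Unset Strict Implicit.
Unset Printing Implicit Defensive.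

(** * Elementary inequalities *)

Section Estimates.
Variable R : realType.
Implicit Types (a b d : R).

(** A quadratic substitute for the triangle inequality.  It can be summed and
    integrated as it stands, and letting d tend to 0 loses nothing, so it
    replaces Minkowski's inequality in all the spaces below. *)
Lemma sqrD_le a b d : 0 < d ->
  (a + b) ^+ 2 <= (1 + d) * a ^+ 2 + (1 + d^-1) * b ^+ 2.
Proof.
move=> d0; rewrite -subr_ge0.
have -> : (1 + d) * a ^+ 2 + (1 + d^-1) * b ^+ 2 - (a + b) ^+ 2
          = d^-1 * (d * a - b) ^+ 2 by field; rewrite gt_eqF.
by rewrite mulr_ge0 ?sqr_ge0 ?invr_ge0 ?ltW.
Qed.

(** The form in which the free parameter of [sqrD_le] is eliminated: d is sent
    to 0 after the error term e. *)
Lemma lee_approx (x y : \bar R) : (0 <= y)%E ->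
  (forall d e : R, 0 < d -> 0 < e -> (x <= (1 + d)%:E * y + e%:E)%E) ->
  (x <= y)%E.
Proof.
case: y => [y||]; rewrite ?leey// lee_fin => y0 H.
apply/lee_addgt0Pr => e e0; have y1 : 0 < y + 1 by rewrite ltr_wpDl.
have d0 : 0 < e / 2 / (y + 1) by rewrite !divr_gt0.
have e2 : 0 < e / 2 by rewrite divr_gt0.
apply: le_trans (H _ _ d0 e2) _.
rewrite -!EFinM -!EFinD lee_fin mulrDl mul1r -addrA lerD2l.
rewrite [leRHS](splitr e) lerD2r mulrAC ler_pdivrMr// ler_pM2l ?divr_gt0//.
by rewrite lerDl.
Qed.

End Estimates.

(** * Complex numbers and the Frobenius inner product *)

Section Complex.
Variable R : realType.
Implicit Types (z w : R[i]) (t : R).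

Lemma normc_sqrE z : Normc.normc z ^+ 2 = complex.Re z ^+ 2 + complex.Im z ^+ 2.
Proof. by case: z => a b /=; rewrite sqr_sqrtr // addr_ge0 ?sqr_ge0. Qed.

Lemma normc_ge0 z : 0 <= Normc.normc z.
Proof. by case: z => a b; exact: sqrtr_ge0. Qed.

Lemma ReCD z w : complex.Re (z + w) = complex.Re z + complex.Re w.
Proof. by case: z w => [? ?] [? ?]. Qed.
Lemma ImCD z w : complex.Im (z + w) = complex.Im z + complex.Im w.
Proof. by case: z w => [? ?] [? ?]. Qed.
Lemma ReCM z w :
  complex.Re (z * w) = complex.Re z * complex.Re w - complex.Im z * complex.Im w.
Proof. by case: z w => [? ?] [? ?]. Qed.
Lemma ImCM z w :
  complex.Im (z * w) = complex.Re z * complex.Im w + complex.Im z * complex.Re w.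
Proof. by case: z w => [? ?] [? ?]. Qed.
Lemma Re_conjc z : complex.Re (conjc z) = complex.Re z.
Proof. by case: z. Qed.
Lemma Im_conjc z : complex.Im (conjc z) = - complex.Im z.
Proof. by case: z. Qed.

Lemma Re_sum I (s : seq I) (P : pred I) (F : I -> R[i]) :
  complex.Re (\sum_(i <- s | P i) F i) = \sum_(i <- s | P i) complex.Re (F i).
Proof. exact: (big_morph (@complex.Re R) ReCD). Qed.

Lemma mul_conjc z : z * conjc z = Complex (Normc.normc z ^+ 2) 0.
Proof.
rewrite normc_sqrE; case: z => a b; apply/eqP; rewrite eq_complex/=.
by apply/andP; split; apply/eqP; ring.
Qed.

(** The weighted arithmetic-geometric mean inequality.  Choosing d well makes it
    as strong as Cauchy-Schwarz in the places where it is used. *)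
Lemma Re_mul_conjc_le z w (d : R) : 0 < d ->
  2 * complex.Re (z * conjc w) <=
  d * Normc.normc z ^+ 2 + d^-1 * Normc.normc w ^+ 2.
Proof.
move=> d0; rewrite ReCM Re_conjc Im_conjc !normc_sqrE -subr_ge0.
set a := complex.Re z; set b := complex.Im z.
set c := complex.Re w; set e := complex.Im w.
have -> : d * (a ^+ 2 + b ^+ 2) + d^-1 * (c ^+ 2 + e ^+ 2) - 2 * (a * c - b * - e)
  = d^-1 * ((d * a - c) ^+ 2 + (d * b - e) ^+ 2) by field; rewrite gt_eqF.
by rewrite mulr_ge0 ?addr_ge0 ?sqr_ge0 ?invr_ge0 ?ltW.
Qed.

Lemma expiD t u : expi (t + u) = expi t * expi u.
Proof. by rewrite /expi cosD sinD; congr Complex; rewrite addrC mulrC. Qed.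

Lemma conj_expi t : conjc (expi t) = expi (- t).
Proof. by rewrite /expi/= cosN sinN. Qed.

Lemma normc_expi t : Normc.normc (expi t) = 1.
Proof. by rewrite /expi/= cos2Dsin2 sqrtr1. Qed.

Lemma expi_pi_int (m : int) : expi (pi * m%:~R : R) = (-1) ^ m.
Proof.
have nat_case k : expi (pi * k%:R : R) = (-1) ^+ k.
  elim: k => [|k IH]; first by rewrite mulr0 /expi cos0 sin0.
  rewrite -addn1 natrD mulrDr mulr1 expiD IH exprD expr1; congr (_ * _).
  by rewrite /expi cospi sinpi; apply/eqP; rewrite eq_complex/= oppr0 !eqxx.
case: m => k; first exact: nat_case.
rewrite NegzE mulrNz mulrN -conj_expi nat_case -exprnN rmorphXn.
by rewrite rmorphN rmorph1 -exprVn invrN1.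
Qed.

End Complex.

Section Frobenius.
Variables (R : realType) (n : nat).
Implicit Types (A B C : 'M[R[i]]_n) (z : R[i]).

Definition frob_dot A B : R[i] := \sum_(m < n) \sum_(k < n) A m k * conjc (B m k).

Lemma sqr_frob_norm A :
  frob_norm A ^+ 2 = \sum_(m < n) \sum_(k < n) Normc.normc (A m k) ^+ 2.
Proof.
rewrite /frob_norm sqr_sqrtr// sumr_ge0// => m _.
by rewrite sumr_ge0// => k _; rewrite sqr_ge0.
Qed.

Lemma frob_dot_diag A : frob_dot A A = Complex (frob_norm A ^+ 2) 0.
Proof.
rewrite sqr_frob_norm -[RHS]/((_)%:C)%C rmorph_sum; apply: eq_bigr => m _.
by rewrite rmorph_sum; apply: eq_bigr => k _; rewrite mul_conjc.
Qed.

Lemma frob_dot_suml I (s : seq I) (P : pred I) (a : I -> R[i]) (f : I -> 'M[R[i]]_n) B :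
  frob_dot (\sum_(i <- s | P i) a i *: f i) B
  = \sum_(i <- s | P i) a i * frob_dot (f i) B.
Proof.
under [RHS]eq_bigr do rewrite mulr_sumr.
rewrite [RHS]exchange_big; apply: eq_bigr => m _.
under [RHS]eq_bigr do rewrite mulr_sumr.
rewrite [RHS]exchange_big; apply: eq_bigr => k _.
rewrite summxE mulr_suml; apply: eq_bigr => i _.
by rewrite mxE mulrA.
Qed.

Lemma frob_dot_sumr I (s : seq I) (P : pred I) (a : I -> R[i]) (f : I -> 'M[R[i]]_n) B :
  frob_dot B (\sum_(i <- s | P i) a i *: f i)
  = \sum_(i <- s | P i) conjc (a i) * frob_dot B (f i).
Proof.
under [RHS]eq_bigr do rewrite mulr_sumr.
rewrite [RHS]exchange_big; apply: eq_bigr => m _.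
under [RHS]eq_bigr do rewrite mulr_sumr.
rewrite [RHS]exchange_big; apply: eq_bigr => k _.
rewrite summxE rmorph_sum mulr_sumr; apply: eq_bigr => i _.
by rewrite mxE rmorphM mulrCA.
Qed.

Lemma frob_dotDr A B C : frob_dot A (B + C) = frob_dot A B + frob_dot A C.
Proof.
rewrite -big_split; apply: eq_bigr => m _; rewrite -big_split.
by apply: eq_bigr => k _; rewrite mxE rmorphD mulrDr.
Qed.

Lemma frob_dotZr A B z : frob_dot A (z *: B) = conjc z * frob_dot A B.
Proof.
rewrite mulr_sumr; apply: eq_bigr => m _; rewrite mulr_sumr.
by apply: eq_bigr => k _; rewrite mxE rmorphM mulrCA.
Qed.

Lemma frob_norm_ge0 A : 0 <= frob_norm A.
Proof. exact: sqrtr_ge0. Qed.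

Lemma frob_normZ z A : frob_norm (z *: A) = Normc.normc z * frob_norm A.
Proof.
rewrite /frob_norm -{1}(ger0_norm (normc_ge0 z)) -sqrtr_sqr -sqrtrM ?sqr_ge0//.
congr Num.sqrt; rewrite mulr_sumr; apply: eq_bigr => m _.
rewrite mulr_sumr; apply: eq_bigr => k _.
by rewrite mxE Normc.normcM exprMn.
Qed.

Lemma frob_norm0 : frob_norm (0 : 'M[R[i]]_n) = 0.
Proof.
apply/eqP; rewrite -sqrf_eq0 sqr_frob_norm big1// => m _; rewrite big1// => k _.
by rewrite mxE Normc.normc0 expr0n.
Qed.

Lemma frob_norm_eq0 A : frob_norm A = 0 -> A = 0.
Proof.
move=> /eqP; rewrite -sqrf_eq0 sqr_frob_norm => /eqP A0.
apply/matrixP => m k; rewrite mxE.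
have ge0 i : 0 <= \sum_(j < n) Normc.normc (A i j) ^+ 2.
  by rewrite sumr_ge0// => *; rewrite sqr_ge0.
have Am0 := (@psumr_eq0P _ _ _ _ (fun i _ => ge0 i) A0) m isT.
have /eqP := (@psumr_eq0P _ _ _ _ (fun j _ => sqr_ge0 (Normc.normc (A m j))) Am0) k isT.
by rewrite sqrf_eq0 => /eqP /Normc.eq0_normc.
Qed.

Lemma sqr_frob_normD_le A B (d : R) : 0 < d ->
  frob_norm (A + B) ^+ 2 <=
  (1 + d) * frob_norm A ^+ 2 + (1 + d^-1) * frob_norm B ^+ 2.
Proof.
move=> d0; rewrite !sqr_frob_norm 2!mulr_sumr -big_split; apply: ler_sum => m _.
rewrite 2!mulr_sumr -big_split; apply: ler_sum => k _ /=.
rewrite mxE !normc_sqrE ReCD ImCD.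
apply: le_trans (lerD (sqrD_le _ _ d0) (sqrD_le _ _ d0)) _.
by rewrite le_eqVlt; apply/orP; left; apply/eqP; ring.
Qed.

Lemma frob_normN A : frob_norm (- A) = frob_norm A.
Proof.
rewrite /frob_norm; congr Num.sqrt; apply: eq_bigr => m _; apply: eq_bigr => k _.
by rewrite mxE normcN.
Qed.

Lemma Re_frob_dot_le A B (d : R) : 0 < d ->
  2 * `|complex.Re (frob_dot A B)| <= d * frob_norm A ^+ 2 + d^-1 * frob_norm B ^+ 2.
Proof.
move=> d0.
have H C : 2 * complex.Re (frob_dot A C) <= d * frob_norm A ^+ 2 + d^-1 * frob_norm C ^+ 2.
  rewrite !sqr_frob_norm /frob_dot Re_sum 3!mulr_sumr -big_split; apply: ler_sum => m _.
  rewrite Re_sum 3!mulr_sumr -big_split; apply: ler_sum => k _.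
  exact: Re_mul_conjc_le.
case: (ger0P (complex.Re (frob_dot A B))) => _; first exact: H.
have := H (- B); rewrite frob_normN.
rewrite (_ : frob_dot A (- B) = - frob_dot A B); last first.
  by rewrite -scaleN1r frob_dotZr rmorphN rmorph1 mulN1r.
by case: (frob_dot A B).
Qed.

(** The imaginary part of a product with B is the real part of the product with
    i B. *)
Lemma Im_frob_dot_le A B :
  2 * `|complex.Im (frob_dot A B)| <= frob_norm A ^+ 2 + frob_norm B ^+ 2.
Proof.
have := @Re_frob_dot_le A (Complex 0 1 *: B) 1 ltr01.
rewrite frob_dotZr frob_normZ invr1 !mul1r ReCM/= expr0n/= expr1n add0r sqrtr1.
by rewrite mul1r mul0r sub0r mulN1r opprK.
Qed.

End Frobenius.

(** * Orthonormality of the exponentials on Omega *)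

Section OmegaIntegral.
Variables (R : realType) (N : nat).
Hypothesis N_gt0 : (0 < N)%N.
Let mu := @lebesgue_measure R.

Lemma measurable_Omega : measurable (Omega R N).
Proof. by apply: measurableU; exact: measurable_itv. Qed.

Lemma disjoint_Omega :
  [disjoint `[0, 2^-1[%classic & `[N%:R / 2, (N%:R + 1) / 2[%classic :> set R].
Proof.
apply/disj_set2P; apply/seteqP; split => // x [] /=; rewrite !in_itv/=.
move=> /andP[_ x2] /andP[Nx _]; have := le_lt_trans Nx x2.
by rewrite ltr_pdivrMr// mulVf// ltrn1; case: N N_gt0.
Qed.

Lemma integrable_Omega (f : R -> R) :
  continuous f -> mu.-integrable (Omega R N) (EFin \o f).
Proof.
move=> cf.
apply: (@integrableS _ _ _ mu `[0, (N%:R + 1) / 2]).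
- exact: measurable_itv.
- exact: measurable_Omega.
- move=> x [] /=; rewrite !in_itv/= => /andP[x1 x2]; apply/andP; split => //.
  + apply: le_trans (ltW x2) _; rewrite -[leLHS]mul1r ler_pM2r ?invr_gt0//.
    by rewrite lerDr.
  + by apply: le_trans _ x1; rewrite divr_ge0.
  + exact: ltW.
- apply: continuous_compact_integrable; first exact: segment_compact.
  by apply: continuous_subspaceT => x; exact: cf.
Qed.

Lemma integral_itv_FTC (f F : R -> R) (a b : R) : a < b -> continuous f ->
  (forall x : R, is_derive x (1 : R) F (f x)) ->
  (\int[mu]_(x in `[a, b[) (f x)%:E = (F b - F a)%:E)%E.
Proof.
move=> ab cf dF.
have cF : continuous F.
  by move=> x; apply: differentiable_continuous; apply/derivable1_diffP; case: (dF x).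
rewrite integral_itv_bndo_bndc; last first.
  apply/measurable_EFinP; apply: (@measurable_funS _ _ _ _ setT) => //.
  exact: continuous_measurable_fun.
rewrite (@continuous_FTC2 _ f F)//.
- by apply: continuous_subspaceT => x; exact: cf.
- split => //; [apply: cvg_at_right_filter|apply: cvg_at_left_filter]; exact: cF.
- by move=> x _; rewrite derive1E derive_val.
Qed.

Lemma integral_Omega_FTC (f F : R -> R) : continuous f ->
  (forall x : R, is_derive x (1 : R) F (f x)) ->
  (\int[mu]_(x in Omega R N) (f x)%:E =
   (F 2^-1 - F 0 + (F ((N%:R + 1) / 2) - F (N%:R / 2)))%:E)%E.
Proof.
move=> cf dF; rewrite /Omega integral_setU//.
- rewrite !(integral_itv_FTC _ cf dF)//.
  by rewrite ltr_pM2r ?invr_gt0// ltrDl.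
- apply/measurable_EFinP; apply: (@measurable_funS _ _ _ _ setT) => //.
  exact: continuous_measurable_fun.
- exact: disjoint_Omega.
Qed.

Lemma continuous_expi (w : R) (z : R[i]) :
  continuous (fun x : R => complex.Re (expi (w * x) * z)).
Proof.
move=> x; rewrite [X in continuous_at _ X](_ : _ = fun y =>
  cos (w * y) * complex.Re z - sin (w * y) * complex.Im z); last first.
  by apply/funext => y; rewrite ReCM.
apply: cvgB; apply: cvgMl.
  by apply: continuous_comp; [exact: mulrl_continuous|exact: continuous_cos].
by apply: continuous_comp; [exact: mulrl_continuous|exact: continuous_sin].
Qed.

Lemma integral_expi_0 (z : R[i]) :
  (\int[mu]_(x in Omega R N) (complex.Re (expi (0 * x) * z))%:E
   = (complex.Re z)%:E)%E.
Proof.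
have dF (x : R) : is_derive x (1 : R) (fun x => complex.Re z * x)
    (complex.Re (expi (0 * x) * z)).
  rewrite mul0r /expi cos0 sin0 ReCM/= mul1r mul0r subr0.
  by apply: is_derive_eq; rewrite scaler1.
rewrite (integral_Omega_FTC (@continuous_expi 0 z) dF).
by congr EFin; field.
Qed.

(** The antiderivative is Im (exp(i w x) z) / w, and the boundary terms factor
    as (exp(i w / 2) - 1) (1 + exp(i w N / 2)). *)
Lemma integral_expi (w : R) (z : R[i]) : w != 0 ->
  (expi (w / 2) = 1 \/ expi (w * (N%:R / 2)) = -1) ->
  (\int[mu]_(x in Omega R N) (complex.Re (expi (w * x) * z))%:E = 0)%E.
Proof.
move=> w0 H.
have dF (x : R) : is_derive x (1 : R)
    (fun x => w^-1 * complex.Im (expi (w * x) * z))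
    (complex.Re (expi (w * x) * z)).
  rewrite [X in is_derive _ _ X](_ : _ = fun y =>
    w^-1 * (cos (w * y) * complex.Im z + sin (w * y) * complex.Re z)); last first.
    by apply/funext => y; rewrite ImCM.
  apply: is_derive_eq; rewrite ReCM /GRing.scale/=.
  by field.
rewrite (integral_Omega_FTC (@continuous_expi w z) dF).
congr EFin; rewrite -!mulrBr -mulrDr; apply/eqP; rewrite mulf_eq0 invr_eq0.
rewrite (negbTE w0)/= mulr0 mulrDl mul1r mulrDr expiD.
suff : expi (w / 2) * z - expi 0 * z +
  (expi (w * (N%:R / 2)) * expi (w / 2) * z - expi (w * (N%:R / 2)) * z) = 0.
  by move=> /(congr1 (@complex.Im R)); rewrite !ImCD !raddfN/= => E; apply/eqP.
have -> : expi 0 = 1 :> R[i] by rewrite /expi cos0 sin0.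
by case: H => ->; ring.
Qed.

End OmegaIntegral.

Section FiniteParseval.
Variables (R : realType) (n N r : nat).
Hypotheses (N_gt0 : (0 < N)%N) (r_odd : odd r).
Let mu := @lebesgue_measure R.

(** The difference of two points of Lambda is an even integer if they lie in the
    same class modulo 2.  Otherwise N times it is r or - r plus an even integer,
    which is odd. *)
Lemma Lambda_diff (l l' : R) : Lambda R N r l -> Lambda R N r l' ->
  expi (pi * (l - l')) = 1 \/ expi (pi * ((l - l') * N%:R)) = -1.
Proof.
have N0 : N%:R != 0 :> R by rewrite pnatr_eq0 -lt0n.
have even (m : int) : (-1) ^ (2 * m) = 1 :> R[i].
  by rewrite -exprz_exp -exprnP sqrrN expr1n exp1rz.
case=> a aA [k _ <-] [a' a'A [k' _ <-]].
have E : a + 2 * k%:~R - (a' + 2 * k'%:~R) = (a - a') + (2 * (k - k'))%:~R.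
  by rewrite rmorphM rmorphB/=; ring.
have odd_case (s : int) : a - a' = (s * r%:Z)%:~R / N%:R -> s = 1 \/ s = -1 ->
    expi (pi * ((a + 2 * k%:~R - (a' + 2 * k'%:~R)) * N%:R)) = -1 :> R[i].
  move=> aE s1.
  have -> : (a + 2 * k%:~R - (a' + 2 * k'%:~R)) * N%:R
     = (s * r%:Z + 2 * ((k - k') * N%:Z))%:~R.
    by rewrite E aE mulrDl divfK// rmorphD/=; congr (_ + _); rewrite mulrA [RHS]rmorphM/=.
  rewrite expi_pi_int expfzDr ?oppr_eq0 ?oner_eq0// even mulr1.
  have r1 : (-1) ^+ r = -1 :> R[i] by rewrite -signr_odd r_odd.
  case: s1 => ->; rewrite ?mul1r ?mulN1r; first exact: r1.
  by rewrite -exprnN r1 invrN1.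
move: aA a'A E odd_case => [] -> [] -> E odd_case.
- left; rewrite E subrr add0r; rewrite expi_pi_int; exact: even.
- right; apply: (odd_case (-1)); last by right.
  by rewrite sub0r mulN1r rmorphN/= mulNr.
- right; apply: (odd_case 1); last by left.
  by rewrite subr0 mul1r.
- left; rewrite E subrr add0r; rewrite expi_pi_int; exact: even.
Qed.

Lemma integral_expi_Lambda (l l' : Lambda R N r) (z : R[i]) :
  (\int[mu]_(x in Omega R N)
     (complex.Re (expi (2 * pi * (val l - val l') * x) * z))%:E
   = (if l == l' then complex.Re z else 0)%:E)%E.
Proof.
case: eqVneq => [->|ll'].
  by rewrite subrr mulr0 integral_expi_0.
have q0 : val l - val l' != 0 by rewrite subr_eq0; apply: contra ll' => /eqP/val_inj ->.
apply: (integral_expi N_gt0).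
  by rewrite !mulf_neq0// gt_eqF ?pi_gt0.
have [H|H] := @Lambda_diff _ _ (set_valP l) (set_valP l').
  by left; rewrite -[RHS]H; congr expi; field.
by right; rewrite -[RHS]H; congr expi; field.
Qed.

Lemma frob_norm_trig_sum (f : Lambda R N r -> 'M[R[i]]_n) (A : {fset Lambda R N r}) x :
  frob_norm (\sum_(l <- A) expi (2 * pi * val l * x) *: f l) ^+ 2 =
  \sum_(l <- A) \sum_(l' <- A)
    complex.Re (expi (2 * pi * (val l - val l') * x) * frob_dot (f l) (f l')).
Proof.
have -> B : frob_norm B ^+ 2 = complex.Re (@frob_dot R n B B) by rewrite frob_dot_diag.
rewrite frob_dot_suml Re_sum; apply: eq_bigr => l _.
rewrite frob_dot_sumr mulr_sumr Re_sum; apply: eq_bigr => l' _.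
rewrite conj_expi mulrA -expiD; do 3 f_equal; ring.
Qed.

Lemma integral_trig_sum (f : Lambda R N r -> 'M[R[i]]_n) (A : {fset Lambda R N r}) :
  (\int[mu]_(x in Omega R N)
     (frob_norm (\sum_(l <- A) expi (2 * pi * val l * x) *: f l) ^+ 2)%:E
   = (\sum_(l <- A) frob_norm (f l) ^+ 2)%:E)%E.
Proof.
under eq_integral => x _.
  rewrite frob_norm_trig_sum -sumEFin.
  under eq_bigr do rewrite -sumEFin.
  over.
have int l l' : mu.-integrable (Omega R N) (fun x =>
    (complex.Re (expi (2 * pi * (val l - val l') * x) * frob_dot (f l) (f l')))%:E).
  exact: (integrable_Omega N (@continuous_expi R _ (frob_dot (f l) (f l')))).
have mO := @measurable_Omega R N.
rewrite integral_sum//; last by move=> l; exact: integrable_sum.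
rewrite -sumEFin big_seq [RHS]big_seq; apply: eq_bigr => l lA.
rewrite integral_sum//; under eq_bigr do rewrite integral_expi_Lambda.
rewrite sumEFin; congr EFin.
rewrite (big_fsetD1 l)//= eqxx frob_dot_diag/= big_seq big1 ?addr0// => l'.
by rewrite !inE eq_sym => /andP[/negbTE ->].
Qed.

End FiniteParseval.

(** * Square integrals of matrix-valued functions *)

Section Energy.
Variables (R : realType) (n N : nat).
Let mu := @lebesgue_measure R.
Implicit Types F G : R -> 'M[R[i]]_n.

Definition energy F : \bar R :=
  (\int[mu]_(x in Omega R N) (frob_norm (F x) ^+ 2)%:E)%E.

Definition mx_measurable F := forall m k,
  measurable_fun (Omega R N) (fun x => complex.Re (F x m k)) /\
  measurable_fun (Omega R N) (fun x => complex.Im (F x m k)).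

Lemma energy_ge0 F : (0 <= energy F)%E.
Proof. by apply: integral_ge0 => x _; rewrite lee_fin sqr_ge0. Qed.

Lemma measurable_frob F : mx_measurable F ->
  measurable_fun (Omega R N) (fun x => (frob_norm (F x) ^+ 2)%:E).
Proof.
move=> mF; apply/measurable_EFinP; under eq_fun do rewrite sqr_frob_norm.
apply: measurable_sum => m; apply: measurable_sum => k.
under eq_fun do rewrite normc_sqrE.
by apply: measurable_funD; apply: measurable_funX; case: (mF m k).
Qed.

Lemma mx_measurableD F G : mx_measurable F -> mx_measurable G ->
  mx_measurable (fun x => F x + G x).
Proof.
move=> mF mG m k; have [F1 F2] := mF m k; have [G1 G2] := mG m k; split.
  by under eq_fun do rewrite mxE ReCD; exact: measurable_funD.
by under eq_fun do rewrite mxE ImCD; exact: measurable_funD.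
Qed.

Lemma mx_measurableZ (w : R -> R[i]) F :
  measurable_fun (Omega R N) (fun x => complex.Re (w x)) ->
  measurable_fun (Omega R N) (fun x => complex.Im (w x)) ->
  mx_measurable F -> mx_measurable (fun x => w x *: F x).
Proof.
move=> w1 w2 mF m k; have [F1 F2] := mF m k; split.
  under eq_fun do rewrite mxE ReCM.
  by apply: measurable_funB; apply: measurable_funM.
under eq_fun do rewrite mxE ImCM.
by apply: measurable_funD; apply: measurable_funM.
Qed.

Lemma mx_measurable_cst (A : 'M[R[i]]_n) : mx_measurable (fun=> A).
Proof. by move=> m k; split; exact: measurable_cst. Qed.

Lemma measurable_cos (w : R) : measurable_fun (Omega R N) (fun x => cos (w * x)).
Proof.
apply: (@measurable_funS _ _ _ _ setT) => //; apply: continuous_measurable_fun => x.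
by apply: continuous_comp; [exact: mulrl_continuous|exact: continuous_cos].
Qed.

Lemma measurable_sin (w : R) : measurable_fun (Omega R N) (fun x => sin (w * x)).
Proof.
apply: (@measurable_funS _ _ _ _ setT) => //; apply: continuous_measurable_fun => x.
by apply: continuous_comp; [exact: mulrl_continuous|exact: continuous_sin].
Qed.

Lemma mx_measurable_expi (w : R) F : mx_measurable F ->
  mx_measurable (fun x => expi (w * x) *: F x).
Proof. by apply: mx_measurableZ; [exact: measurable_cos|exact: measurable_sin]. Qed.

Lemma mx_measurable_scale (c : R[i]) F : mx_measurable F ->
  mx_measurable (fun x => c *: F x).
Proof. by apply: mx_measurableZ; exact: measurable_cst. Qed.

Lemma mx_measurableB F G : mx_measurable F -> mx_measurable G ->
  mx_measurable (fun x => F x - G x).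
Proof.
move=> mF mG; under eq_fun do rewrite -scaleN1r.
by apply: mx_measurableD => //; exact: mx_measurable_scale.
Qed.

Lemma mx_measurable_sum I (s : seq I) (F : I -> R -> 'M[R[i]]_n) :
  (forall i, mx_measurable (F i)) ->
  mx_measurable (fun x => \sum_(i <- s) F i x).
Proof.
move=> mF; elim: s => [|i s IH].
  by under eq_fun do rewrite big_nil; exact: mx_measurable_cst.
by under eq_fun do rewrite big_cons; exact: mx_measurableD.
Qed.

Lemma energyD_le F G (d : R) : 0 < d -> mx_measurable F -> mx_measurable G ->
  (energy (fun x => (F x + G x)%R) <=
   (1 + d)%:E * energy F + (1 + d^-1)%:E * energy G)%E.
Proof.
move=> d0 mF mG; have mO := @measurable_Omega R N.
have d1 : 0 <= 1 + d by rewrite addr_ge0 ?ltW.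
have d2 : 0 <= 1 + d^-1 by rewrite addr_ge0 ?invr_ge0 ?ltW.
have mF2 := measurable_frob mF; have mG2 := measurable_frob mG.
have ge0 (A : 'M[R[i]]_n) : (0 <= (frob_norm A ^+ 2)%:E)%E by rewrite lee_fin sqr_ge0.
rewrite /energy -!ge0_integralZl_EFin//= -?ge0_integralD//=; last 4 first.
- by move=> x _; rewrite mule_ge0 ?lee_fin ?sqr_ge0.
- exact: measurable_funeM.
- by move=> x _; rewrite mule_ge0 ?lee_fin ?sqr_ge0.
- exact: measurable_funeM.
apply: ge0_le_integral => //.
- by apply: measurable_frob; exact: mx_measurableD.
- by apply: emeasurable_funD; exact: measurable_funeM.
- by move=> x _; rewrite -!EFinM -EFinD lee_fin sqr_frob_normD_le.
Qed.

(** Multipliers of constant modulus cover both scalars and the exponentials that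
    represent shifts. *)
Lemma energyZ (w : R -> R[i]) (c : R) F : mx_measurable F ->
  (forall x, Normc.normc (w x) ^+ 2 = c) ->
  energy (fun x => w x *: F x) = (c%:E * energy F)%E.
Proof.
move=> mF wc; have c0 : 0 <= c by rewrite -(wc 0) sqr_ge0.
rewrite /energy -ge0_integralZl_EFin//=.
- by apply: eq_integral => x _; rewrite frob_normZ exprMn wc EFinM.
- exact: measurable_Omega.
- by move=> x _; rewrite lee_fin sqr_ge0.
- exact: measurable_frob.
Qed.

Lemma energyN F : energy (fun x => - F x) = energy F.
Proof. by apply: eq_integral => x _; rewrite frob_normN. Qed.

End Energy.

(** * Fourier transform and Parseval's identity *)

Section Fourier.
Variables (R : realType) (n N r : nat).
Hypotheses (N_gt0 : (0 < N)%N) (r_odd : odd r).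
Let mu := @lebesgue_measure R.
Notation L := (Lambda R N r).
Implicit Types (f g : L -> 'M[R[i]]_n) (F G : R -> 'M[R[i]]_n) (A B : {fset L}).

Definition trig_sum f A (x : R) : 'M[R[i]]_n :=
  \sum_(l <- A) expi (2 * pi * val l * x) *: f l.

Lemma mx_measurable_trig_sum f A : mx_measurable N (trig_sum f A).
Proof.
by apply: mx_measurable_sum => l; apply: mx_measurable_expi; exact: mx_measurable_cst.
Qed.

Lemma energy_trig_sum f A :
  energy N (trig_sum f A) = (\sum_(l <- A) frob_norm (f l) ^+ 2)%:E.
Proof. exact: integral_trig_sum. Qed.

Let errE f F B :
  (\int[mu]_(x in Omega R N) (frob_norm (F x - summability.partial_sum
    (fun l : L => expi (2 * pi * val l * x) *: f l) B) ^+ 2)%:E)%E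
  = energy N (fun x => F x - trig_sum f B x).
Proof.
apply: eq_integral => x _.
by rewrite /summability.partial_sum /trig_sum big_seq_fsetE.
Qed.

(** The limit along finite subsets of Lambda, spelled out with quantifiers. *)
Lemma is_fourierP f F : is_fourier f F <->
  [/\ mx_measurable N F, (energy N F < +oo)%E &
   forall e : R, 0 < e -> exists A, forall B, (A `<=` B)%fset ->
     (energy N (fun x => F x - trig_sum f B x)%R <= e%:E)%E].
Proof.
split=> [[[mF iF] cF]|[mF iF cF]].
  split=> // e e0.
  have [A _ HA] : \forall B \near @summability.totally L,
      ((fun y : \bar R => y < e%:E)%E) (energy N (fun x => F x - trig_sum f B x)).
    have := cF _ (@open_ereal_lt' R 0%E e%:E e0).
    have FF := @summability.totally_filter L.
    by apply: (@filterS _ _ FF) => B HB; rewrite -(errE f F B).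
  by exists A => B AB; apply/ltW/HA.
split; first by split.
move=> S [e /= e0 HS]; have e2 : 0 < e / 2 by rewrite divr_gt0.
have [A HA] := cF _ e2.
exists A => // B /= AB.
have := HA B AB; have := @energy_ge0 R n N (fun x => F x - trig_sum f B x).
rewrite -errE; case: (integral _ _ _) => //= y; rewrite !lee_fin => y0 ye.
apply: HS; rewrite /ball/= sub0r normrN ger0_norm//.
by apply: le_lt_trans ye _; rewrite ltr_pdivrMr// ltr_pMr// ltr1n.
Qed.

Lemma is_fourierD f g F G : is_fourier f F -> is_fourier g G ->
  is_fourier (fun l => f l + g l) (fun x => F x + G x).
Proof.
move=> /is_fourierP[mF iF cF] /is_fourierP[mG iG cG]; apply/is_fourierP; split.
- exact: mx_measurableD.
- apply: le_lt_trans (energyD_le ltr01 mF mG) _.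
  by rewrite invr1 lte_add_pinfty// lte_mul_pinfty// lee_fin addr_ge0.
- move=> e e0; have e4 : 0 < e / 4 by rewrite divr_gt0.
  have [A HA] := cF _ e4; have [A' HA'] := cG _ e4.
  exists (A `|` A')%fset => B; rewrite fsubUset => /andP[AB A'B].
  under [X in energy _ X]eq_fun => x.
    rewrite (_ : _ - _ = (F x - trig_sum f B x) + (G x - trig_sum g B x)); last first.
      rewrite [trig_sum _ B x](_ : _ = trig_sum f B x + trig_sum g B x).
        by rewrite opprD addrACA.
      by rewrite /trig_sum -big_split; apply: eq_bigr => l _; rewrite scalerDr.
    over.
  apply: le_trans (energyD_le ltr01 _ _) _.
  + by apply: mx_measurableB => //; exact: mx_measurable_trig_sum.
  + by apply: mx_measurableB => //; exact: mx_measurable_trig_sum.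
  rewrite invr1.
  have -> : e%:E = ((1 + 1)%:E * (e / 4)%:E + (1 + 1)%:E * (e / 4)%:E)%E.
    by rewrite -!EFinM -EFinD; congr EFin; field.
  by apply: leeD; rewrite lee_pmul2l ?lte_fin ?addr_gt0//; [exact: HA|exact: HA'].
Qed.

Lemma is_fourierZ (c : R[i]) f F : is_fourier f F ->
  is_fourier (fun l => c *: f l) (fun x => c *: F x).
Proof.
move=> /is_fourierP[mF iF cF]; apply/is_fourierP; split.
- exact: mx_measurable_scale.
- rewrite (@energyZ _ _ _ (fun=> c) (Normc.normc c ^+ 2))//.
  by rewrite lte_mul_pinfty// lee_fin sqr_ge0.
- move=> e e0; set k := Normc.normc c ^+ 2 + 1.
  have k0 : 0 < k by rewrite ltr_wpDl ?sqr_ge0.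
  have [A HA] := cF (e / k) (divr_gt0 e0 k0); exists A => B AB.
  under [X in energy _ X]eq_fun => x.
    rewrite (_ : _ - _ = c *: (F x - trig_sum f B x)); last first.
      rewrite scalerBr; congr (_ - _); rewrite scaler_sumr; apply: eq_bigr => l _.
      by rewrite scalerA mulrC -scalerA.
    over.
  rewrite (@energyZ _ _ _ (fun=> c) (Normc.normc c ^+ 2))//; last first.
    by apply: mx_measurableB => //; exact: mx_measurable_trig_sum.
  apply: le_trans (_ : (k%:E * (e / k)%:E <= _)%E); last first.
    by rewrite -EFinM lee_fin mulrC divfK// gt_eqF.
  apply: lee_pmul; rewrite ?lee_fin ?sqr_ge0 ?energy_ge0 ?HA//.
  by rewrite lerDl.
Qed.

Lemma is_fourierB f g F G : is_fourier f F -> is_fourier g G ->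
  is_fourier (fun l => f l - g l) (fun x => F x - G x).
Proof.
move=> fF gG; have := is_fourierD fF (is_fourierZ (-1) gG).
by under eq_fun do rewrite scaleN1r; under [X in is_fourier _ X]eq_fun do rewrite scaleN1r.
Qed.

(** Since 2 N l is an even integer, the shift by 2 N l is a bijection of Lambda;
    this provides its inverse. *)
Lemma Lambda_unshift (l l' : L) : val l' + (2 * N)%:R * val l \in Lambda R N r.
Proof.
have [z ->] : exists z : int, (2 * N)%:R * val l = 2 * z%:~R.
  case: (set_valP l) => a a0r [k _ /= <-].
  have [m ->] : exists m : int, a = m%:~R / N%:R.
    case: a0r => ->; first by exists 0; rewrite mul0r.
    by exists r%:Z.
  exists (m + 2 * k * N%:Z); rewrite natrM rmorphD rmorphM rmorphM/=.
  by field; rewrite pnatr_eq0 -lt0n.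
case: (set_valP l') => a a0r [k _ /= E]; apply/mem_set.
by exists a => //; exists (k + z) => //; rewrite -E rmorphD/= mulrDr addrA.
Qed.

(** Partial sums of the displaced sequence over B are, up to the modulating
    exponential, partial sums of f over the shifted set, and shifting is a
    bijection of the finite subsets of Lambda that preserves inclusion. *)
Lemma is_fourier_displacement (l : L) f F : is_fourier f F ->
  is_fourier (displacement l f)
    (fun x => expi (2 * pi * ((2 * N)%:R * val l) * x) *: F x).
Proof.
move=> /is_fourierP[mF iF cF]; apply/is_fourierP; split.
- exact: mx_measurable_expi.
- rewrite (@energyZ _ _ _ _ 1)// ?mul1e// => x.
  by rewrite normc_expi expr1n.
pose s l' : L := SigSub (Lambda_shift l l').
pose t l' : L := SigSub (Lambda_unshift l l').
have ts : cancel t s by move=> l'; apply/val_inj; rewrite /= addrK.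
have st : cancel s t by move=> l'; apply/val_inj; rewrite /= subrK.
move=> e e0; have [A HA] := cF e e0.
exists (t @` A)%fset => B AB.
have AsB : (A `<=` s @` B)%fset.
  apply/fsubsetP => a aA; rewrite -(ts a) in_imfset//=.
  by apply: (fsubsetP AB); rewrite in_imfset.
apply: le_trans (HA _ AsB).
under [X in energy _ X]eq_fun => x.
  rewrite (_ : _ - _ =
    expi (2 * pi * ((2 * N)%:R * val l) * x) *: (F x - trig_sum f (s @` B)%fset x)).
    over.
  rewrite scalerBr; congr (_ - _); rewrite scaler_sumr.
  rewrite big_imfset/=; last by move=> ? ? _ _; exact: (can_inj st).
  apply: eq_bigr => l' _; rewrite scalerA -expiD; congr (expi _ *: _).
  by rewrite /=; ring.
rewrite (@energyZ _ _ _ _ 1) ?mul1e//.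
- by apply: mx_measurableB => //; exact: mx_measurable_trig_sum.
- by move=> x; rewrite normc_expi expr1n.
Qed.

Lemma is_fourier_shift_sum (s : seq L) (c : L -> R[i]) f F : is_fourier f F ->
  is_fourier (fun l' => \sum_(l <- s) c l *: displacement l f l')
    (fun x => (\sum_(l <- s) c l * expi (2 * pi * ((2 * N)%:R * val l) * x)) *: F x).
Proof.
move=> fF; elim: s => [|l s IH].
  under eq_fun do rewrite big_nil; under [X in is_fourier _ X]eq_fun do rewrite big_nil.
  have := is_fourierZ 0 fF; under eq_fun do rewrite scale0r.
  by [].
under eq_fun do rewrite big_cons.
under [X in is_fourier _ X]eq_fun do rewrite big_cons scalerDl -scalerA.
exact: (is_fourierD (is_fourierZ (c l) (is_fourier_displacement l fF)) IH).
Qed.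

(** The two inequalities compare F with a partial sum S of its series in the two
    orders F = S + (F - S) and S = F + (S - F).  The energy of F - S is as small
    as desired, and that of S is a finite sum of squares by orthonormality. *)
Lemma parseval f F : is_fourier f F ->
  (\esum_(l in [set: L]) (frob_norm (f l) ^+ 2)%:E = energy N F)%E.
Proof.
move=> /is_fourierP[mF iF cF].
have frob_ge0 l : (0 <= (frob_norm (f l) ^+ 2)%:E)%E by rewrite lee_fin sqr_ge0.
have sumE B : (\sum_(l \in [set` B]) (frob_norm (f l) ^+ 2)%:E =
    (\sum_(l <- B) frob_norm (f l) ^+ 2)%:E)%E.
  by rewrite fsbig_finite//= set_fsetK sumEFin.
apply/eqP; rewrite eq_le; apply/andP; split.
- apply: lee_approx; first exact: energy_ge0.
  move=> d e d0 e0; have d1 : 0 < 1 + d^-1 by rewrite addr_gt0 ?invr_gt0.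
  apply: ge_ereal_sup => _ [X [finX _] <-].
  have [A HA] := cF _ (divr_gt0 e0 d1).
  rewrite -(fset_setK finX); set B := (A `|` fset_set X)%fset.
  apply: (@le_trans _ _ (energy N (trig_sum f B))).
    rewrite energy_trig_sum -sumE; apply: lee_fsum_nneg_subset => //.
    by move=> l /set_mem lX; apply/mem_set; apply: (fsubsetP (fsubsetUr _ _)).
  rewrite (_ : trig_sum f B = fun x => F x + (trig_sum f B x - F x)); last first.
    by apply/funext => x; rewrite addrC subrK.
  have mS := mx_measurable_trig_sum f B.
  apply: le_trans (energyD_le d0 mF (mx_measurableB mS mF)) _.
  have -> : energy N (fun x => trig_sum f B x - F x)
          = energy N (fun x => F x - trig_sum f B x).
    by rewrite -energyN; congr energy; apply/funext => x; rewrite opprB.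
  rewrite leeD2l//.
  have -> : e%:E = ((1 + d^-1)%:E * (e / (1 + d^-1))%:E)%E.
    by rewrite -EFinM mulrC divfK// gt_eqF.
  by rewrite lee_pmul2l// HA// fsubsetUl.
- apply: lee_approx; first exact: esum_ge0.
  move=> d e d0 e0; have d1 : 0 < 1 + d^-1 by rewrite addr_gt0 ?invr_gt0.
  have [A HA] := cF _ (divr_gt0 e0 d1).
  rewrite [X in energy N X](_ : _ = fun x => trig_sum f A x + (F x - trig_sum f A x)); last first.
    by apply/funext => x; rewrite addrC subrK.
  have mS := mx_measurable_trig_sum f A.
  apply: le_trans (energyD_le d0 mS (mx_measurableB mF mS)) _.
  apply: leeD.
    rewrite lee_pmul2l ?lte_fin ?addr_gt0// energy_trig_sum -sumE.
    by apply: esum_ge; exists [set` A].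
  have -> : e%:E = ((1 + d^-1)%:E * (e / (1 + d^-1))%:E)%E.
    by rewrite -EFinM mulrC divfK// gt_eqF.
  by rewrite lee_pmul2l// HA.
Qed.

End Fourier.

(** * Sums of absolutely summable families *)

Section RealSum.
Variables (R : realType) (I : choiceType).
Implicit Types (u v p q : I -> R) (a : R).

Definition abs_summable u : Prop := (\esum_(i in [set: I]) `|u i|%:E < +oo)%E.

Lemma abs_summable_le u v : (forall i, `|u i| <= `|v i|) ->
  abs_summable v -> abs_summable u.
Proof. by move=> uv; apply: le_lt_trans; apply: le_esum => i _; rewrite lee_fin. Qed.

Lemma abs_summableD u v : abs_summable u -> abs_summable v ->
  abs_summable (fun i => u i + v i).
Proof.
move=> su sv; apply: le_lt_trans (lte_add_pinfty su sv).
rewrite -esumD; try by move=> i _; rewrite lee_fin.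
by apply: le_esum => i _; rewrite -EFinD lee_fin ler_normD.
Qed.

Lemma esumZ a p : 0 <= a -> (forall i, 0 <= p i) ->
  (\esum_(i in [set: I]) (a * p i)%:E = a%:E * \esum_(i in [set: I]) (p i)%:E)%E.
Proof.
move=> a0 p0.
have le b q : 0 <= b -> (forall i, 0 <= q i) ->
  (\esum_(i in [set: I]) (b * q i)%:E <= b%:E * \esum_(i in [set: I]) (q i)%:E)%E.
  move=> b0 q0; apply: ge_ereal_sup => _ [X [finX _] <-].
  under eq_fsbigr do rewrite EFinM.
  rewrite fsbig_finite//= -ge0_sume_distrr; last by move=> i _; rewrite lee_fin.
  rewrite lee_wpmul2l ?lee_fin//; apply: esum_ge; exists X => //.
  by rewrite fsbig_finite.
have [->|a_neq0] := eqVneq a 0.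
  by rewrite mul0e esum1// => i _; rewrite mul0r.
apply/eqP; rewrite eq_le le//=.
have a_gt0 : 0 < a by rewrite lt0r a_neq0.
rewrite -lee_pdivlMl// -[X in (X <= _)%E](@eq_esum _ _ _ (fun i => (a^-1 * (a * p i))%:E)).
  by apply: le => [|i]; rewrite ?invr_ge0 ?mulr_ge0.
by move=> i _; rewrite mulKf.
Qed.

Lemma abs_summable_fin p : abs_summable p -> (forall i, 0 <= p i) ->
  (\esum_(i in [set: I]) (p i)%:E)%E \is a fin_num.
Proof.
move=> sp p0; rewrite ge0_fin_numE; last by apply: esum_ge0 => i _; rewrite lee_fin.
by apply: le_lt_trans sp; apply: le_esum => i _; rewrite lee_fin ler_norm.
Qed.

Lemma abs_summable_pos u : abs_summable u -> abs_summable u^\+.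
Proof.
apply: abs_summable_le => i; rewrite ger0_norm ?funrpos_ge0//.
by rewrite /funrpos ge_max ler_norm normr_ge0.
Qed.

Lemma abs_summableN u : abs_summable u -> abs_summable (\- u).
Proof. by apply: abs_summable_le => i; rewrite normrN. Qed.

Lemma abs_summable_neg u : abs_summable u -> abs_summable u^\-.
Proof. by move=> su; rewrite -funrposN; exact/abs_summable_pos/abs_summableN. Qed.

(** The sum may be computed from any decomposition into nonnegative summable
    families, not only from the positive and negative parts; linearity
    follows. *)
Lemma real_sumB_ge0 p q : (forall i, 0 <= p i) -> (forall i, 0 <= q i) ->
  abs_summable p -> abs_summable q ->
  real_sum (fun i => p i - q i) =
  fine (\esum_(i in [set: I]) (p i)%:E)%E - fine (\esum_(i in [set: I]) (q i)%:E)%E.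
Proof.
move=> p0 q0 sp sq.
have spq : abs_summable (fun i => p i - q i).
  exact: abs_summableD sp (abs_summableN sq).
have := @esumB R I setT (EFin \o p) (EFin \o q) sp sq.
rewrite (_ : (_ \- _)%E = EFin \o (fun i => p i - q i)); last by apply/funext.
rewrite funerpos funerneg => H.
have [sp' sn'] := (abs_summable_pos spq, abs_summable_neg spq).
rewrite /real_sum -!fineB ?abs_summable_fin//.
by congr fine; apply: H => i _; rewrite lee_fin.
Qed.

Lemma real_sum_ge0E p : abs_summable p -> (forall i, 0 <= p i) ->
  real_sum p = fine (\esum_(i in [set: I]) (p i)%:E)%E.
Proof.
move=> sp p0; have s0 : abs_summable (fun=> 0).
  by apply: abs_summable_le sp => i; rewrite normr0.
have := real_sumB_ge0 p0 (fun=> lexx 0) sp s0.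
by under eq_fun do rewrite subr0; rewrite (@esum1 _ _ _ (fun=> 0%:E))// subr0.
Qed.

Lemma abs_summableZ a u : abs_summable u -> abs_summable (fun i => a * u i).
Proof.
rewrite /abs_summable; under [in X in _ -> X]eq_esum do rewrite normrM.
by move=> su; rewrite esumZ// lte_mul_pinfty// lee_fin.
Qed.

Lemma real_sumD u v : abs_summable u -> abs_summable v ->
  real_sum (fun i => u i + v i) = real_sum u + real_sum v.
Proof.
move=> su sv.
have up := abs_summable_pos su; have un := abs_summable_neg su.
have vp := abs_summable_pos sv; have vn := abs_summable_neg sv.
have pos w i : 0 <= w^\+ i by exact: funrpos_ge0.
have neg w i : 0 <= w^\- i by exact: funrneg_ge0.
rewrite [X in real_sum X](_ : _ =
   fun i => (u^\+ i + v^\+ i) - (u^\- i + v^\- i)); last first.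
  apply/funext => i; rewrite opprD addrACA.
  by rewrite -[in LHS](funrposBneg u) -[in LHS](funrposBneg v).
rewrite real_sumB_ge0; [|by move=> i; rewrite addr_ge0| by move=> i; rewrite addr_ge0
  |exact: abs_summableD|exact: abs_summableD].
under eq_esum do rewrite EFinD; under [in X in _ - X]eq_esum do rewrite EFinD.
rewrite !esumD; try by move=> i _; rewrite lee_fin.
by rewrite !fineD ?abs_summable_fin// opprD addrACA.
Qed.

Lemma real_sumZ a u : abs_summable u -> real_sum (fun i => a * u i) = a * real_sum u.
Proof.
move=> su.
have up := abs_summable_pos su; have un := abs_summable_neg su.
have pos w i : 0 <= w^\+ i by exact: funrpos_ge0.
have neg w i : 0 <= w^\- i by exact: funrneg_ge0.
have fineZ b w : (forall i, 0 <= w i) -> abs_summable w -> 0 <= b ->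
  fine (\esum_(i in [set: I]) (b * w i)%:E)%E =
  b * fine (\esum_(i in [set: I]) (w i)%:E)%E.
  by move=> w0 sw b0; rewrite esumZ// fineM// abs_summable_fin.
have [a0|a0] := leP 0 a.
  rewrite [X in real_sum X](_ : _ = fun i => a * u^\+ i - a * u^\- i); last first.
    by apply/funext => i; rewrite -mulrBr -[in LHS](funrposBneg u).
  rewrite real_sumB_ge0; [|by move=> i; rewrite mulr_ge0| by move=> i; rewrite mulr_ge0
    |exact: abs_summableZ|exact: abs_summableZ].
  by rewrite (fineZ a u^\+)// (fineZ a u^\-)// -mulrBr.
have Na0 : 0 <= - a by rewrite oppr_ge0 ltW.
rewrite [X in real_sum X](_ : _ = fun i => (- a) * u^\- i - (- a) * u^\+ i); last first.
  by apply/funext => i; rewrite -mulrBr -[in LHS](funrposBneg u) mulNr -mulrN opprB.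
rewrite real_sumB_ge0; [|by move=> i; rewrite mulr_ge0| by move=> i; rewrite mulr_ge0
  |exact: abs_summableZ|exact: abs_summableZ].
by rewrite (fineZ (- a) u^\-)// (fineZ (- a) u^\+)// -mulrBr mulNr -mulrN opprB.
Qed.

Lemma real_sum_le u v : abs_summable u -> abs_summable v ->
  (forall i, u i <= v i) -> real_sum u <= real_sum v.
Proof.
move=> su sv uv; have svu : abs_summable (fun i => v i - u i).
  exact: abs_summableD sv (abs_summableN su).
rewrite [X in _ <= real_sum X](_ : _ = fun i => u i + (v i - u i)); last first.
  by apply/funext => i; rewrite addrC subrK.
rewrite real_sumD// lerDl real_sum_ge0E//; last by move=> i; rewrite subr_ge0.
by apply: fine_ge0; apply: esum_ge0 => i _; rewrite lee_fin subr_ge0.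
Qed.

End RealSum.

(** * The inner product of square-summable sequences *)

Section Ell2.
Variables (R : realType) (n N r : nat).
Notation L := (Lambda R N r).
Implicit Types (f g h : L -> 'M[R[i]]_n) (c : R[i]).

Lemma ell2E f : ell2 f <-> abs_summable (fun l => frob_norm (f l) ^+ 2).
Proof.
rewrite /ell2 /abs_summable; under [X in _ <-> (X < _)%E]eq_esum do
  rewrite ger0_norm ?sqr_ge0// sqr_frob_norm.
by [].
Qed.

Lemma ell2D f g : ell2 f -> ell2 g -> ell2 (fun l => f l + g l).
Proof.
move=> /ell2E sf /ell2E sg; apply/ell2E.
have := abs_summableD (abs_summableZ (1 + 1) sf) (abs_summableZ (1 + 1) sg).
apply: abs_summable_le => l.
rewrite ger0_norm ?sqr_ge0//; apply: le_trans (ler_norm _).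
by have := sqr_frob_normD_le (f l) (g l) (@ltr01 R); rewrite invr1.
Qed.

Lemma ell2Z c f : ell2 f -> ell2 (fun l => c *: f l).
Proof.
move=> /ell2E sf; apply/ell2E.
have := abs_summableZ (Normc.normc c ^+ 2) sf.
by apply: abs_summable_le => l; rewrite frob_normZ exprMn.
Qed.

Lemma ell2_sum I (s : seq I) (c : I -> R[i]) (f : I -> L -> 'M[R[i]]_n) :
  (forall i, ell2 (f i)) -> ell2 (fun l => \sum_(i <- s) c i *: f i l).
Proof.
move=> sf; elim: s => [|i s IH].
  under eq_fun do rewrite big_nil.
  apply/ell2E; rewrite /abs_summable esum1// => l _.
  by rewrite frob_norm0 expr0n normr0.
by under eq_fun do rewrite big_cons; apply: ell2D => //; exact: ell2Z.
Qed.

Lemma abs_summable_frob_dot f g : ell2 f -> ell2 g ->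
  abs_summable (fun l => complex.Re (frob_dot (f l) (g l))) /\
  abs_summable (fun l => complex.Im (frob_dot (f l) (g l))).
Proof.
move=> /ell2E sf /ell2E sg; have := abs_summableD sf sg.
have le (x y : R) : 2 * `|x| <= y -> `|x| <= `|y|.
  move=> xy; apply: le_trans (ler_norm y); apply: le_trans xy.
  by rewrite ler_peMl ?normr_ge0// ler1n.
split; move: H; apply: abs_summable_le => l; apply: le; last exact: Im_frob_dot_le.
by have := Re_frob_dot_le (f l) (g l) (@ltr01 R); rewrite invr1 !mul1r.
Qed.

Lemma ell2_innerD h f g : ell2 h -> ell2 f -> ell2 g ->
  ell2_inner h (fun l => f l + g l) = ell2_inner h f + ell2_inner h g.
Proof.
move=> eh ef eg.
have [sf1 sf2] := abs_summable_frob_dot eh ef.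
have [sg1 sg2] := abs_summable_frob_dot eh eg.
apply/eqP; rewrite eq_complex/= -!real_sumD//; apply/andP; split; apply/eqP;
  congr real_sum; apply/funext => l; rewrite -/(frob_dot _ _) frob_dotDr.
  exact: ReCD.
exact: ImCD.
Qed.

Lemma ell2_innerZ c h f : ell2 h -> ell2 f ->
  ell2_inner h (fun l => c *: f l) = conjc c * ell2_inner h f.
Proof.
move=> eh ef; have [sf1 sf2] := abs_summable_frob_dot eh ef.
apply/eqP; rewrite eq_complex ReCM ImCM/= -!real_sumZ//.
rewrite -mulN1r -real_sumZ; last exact: abs_summableZ.
rewrite -!real_sumD; try first [exact: abs_summableZ|exact/abs_summableZ/abs_summableZ].
apply/andP; split; apply/eqP;
  congr real_sum; apply/funext => l; rewrite -/(frob_dot _ _) frob_dotZr.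
  by rewrite ReCM mulN1r.
by rewrite ImCM.
Qed.

Lemma ell2_inner_sum I (s : seq I) (c : I -> R[i]) (f : I -> L -> 'M[R[i]]_n) h :
  ell2 h -> (forall i, ell2 (f i)) ->
  ell2_inner h (fun l => \sum_(i <- s) c i *: f i l) =
  \sum_(i <- s) conjc (c i) * ell2_inner h (f i).
Proof.
move=> eh ef; elim: s => [|i s IH].
  under eq_fun do rewrite big_nil; rewrite big_nil.
  have := ell2_innerZ 0 eh eh; rewrite conjc0 mul0r => E; rewrite -[RHS]E.
  by under [in RHS]eq_fun do rewrite scale0r.
rewrite big_cons -IH -ell2_innerZ// -ell2_innerD//.
- by under eq_fun do rewrite big_cons.
- exact: ell2Z.
- exact: ell2_sum.
Qed.

Lemma ell2_normE f : ell2 f ->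
  (ell2_norm f ^+ 2)%:E = (\esum_(l in [set: L]) (frob_norm (f l) ^+ 2)%:E)%E.
Proof.
move=> /ell2E sf.
have E : complex.Re (ell2_inner f f) =
    fine (\esum_(l in [set: L]) (frob_norm (f l) ^+ 2)%:E)%E.
  rewrite -real_sum_ge0E//; last by move=> l; exact: sqr_ge0.
  by congr real_sum; apply/funext => l; rewrite -/(frob_dot _ _) frob_dot_diag.
have ge0 l : 0 <= frob_norm (f l) ^+ 2 by exact: sqr_ge0.
rewrite /ell2_norm sqr_sqrtr E.
  by rewrite fineK// abs_summable_fin.
by rewrite fine_ge0// esum_ge0// => l _; rewrite lee_fin.
Qed.

Lemma Re_ell2_inner_diag f : ell2 f -> complex.Re (ell2_inner f f) = ell2_norm f ^+ 2.
Proof.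
move=> ef; apply: EFin_inj; rewrite ell2_normE//.
have sf := proj1 (ell2E f) ef.
rewrite -[RHS]fineK ?abs_summable_fin//; last by move=> l; exact: sqr_ge0.
rewrite -real_sum_ge0E//; last by move=> l; exact: sqr_ge0.
by congr (real_sum _)%:E; apply/funext => l; rewrite -/(frob_dot _ _) frob_dot_diag.
Qed.

(** With d chosen according to the norms this is Cauchy-Schwarz; the weighted
    form spares the choice and the square roots. *)
Lemma Re_ell2_inner_le f g (d : R) : 0 < d -> ell2 f -> ell2 g ->
  2 * complex.Re (ell2_inner f g) <= d * ell2_norm f ^+ 2 + d^-1 * ell2_norm g ^+ 2.
Proof.
move=> d0 ef eg; have [sr _] := abs_summable_frob_dot ef eg.
have [sf _] := abs_summable_frob_dot ef ef; have [sg _] := abs_summable_frob_dot eg eg.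
rewrite -!Re_ell2_inner_diag//= -!real_sumZ// -real_sumD; try exact: abs_summableZ.
apply: real_sum_le.
- exact: abs_summableZ.
- by apply: abs_summableD; exact: abs_summableZ.
move=> l; rewrite -!/(frob_dot _ _) !frob_dot_diag/=.
apply: le_trans (Re_frob_dot_le (f l) (g l) d0).
by rewrite ler_pM2l// ler_norm.
Qed.

End Ell2.

(** * Bessel bounds and synthesis *)

Section Bessel.
Variables (R : realType) (n N r : nat) (T : choiceType).
Notation L := (Lambda R N r).
Variables (e : T -> L -> 'M[R[i]]_n) (b : R).
Hypotheses (b_gt0 : 0 < b) (e_ell2 : forall t, ell2 (e t)).

(** For S = sum_t c_t e_t one has |S|^2 = sum_t Re (conj c_t <S, e_t>), which is
    at most half of b |c|^2 + (1/b) sum_t |<S, e_t>|^2; the Bessel bound makes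
    the second term at most |S|^2, which is absorbed on the left. *)
Lemma synthesis_le_of_bessel :
  (forall h, ell2 h ->
    (\esum_(t in [set: T]) (Normc.normc (ell2_inner h (e t)) ^+ 2)%:E <=
     (b * ell2_norm h ^+ 2)%:E)%E) ->
  forall (s : {fset T}) (c : T -> R[i]),
    ell2_norm (fun l => \sum_(t <- s) c t *: e t l) ^+ 2 <=
    b * \sum_(t <- s) Normc.normc (c t) ^+ 2.
Proof.
move=> bessel s c; set S := fun l => _.
have eS : ell2 S by exact: ell2_sum.
have SE : ell2_norm S ^+ 2
    = \sum_(t <- s) complex.Re (conjc (c t) * ell2_inner S (e t)).
  by rewrite -Re_ell2_inner_diag// {2}/S ell2_inner_sum// Re_sum.
have young (t : T) : 2 * complex.Re (conjc (c t) * ell2_inner S (e t)) <=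
    b * Normc.normc (c t) ^+ 2 + b^-1 * Normc.normc (ell2_inner S (e t)) ^+ 2.
  have b'_gt0 : 0 < b^-1 by rewrite invr_gt0.
  have := Re_mul_conjc_le (ell2_inner S (e t)) (c t) b'_gt0; rewrite invrK => young.
  by rewrite [conjc (c t) * _]mulrC [leRHS]addrC.
have sums : \sum_(t <- s) Normc.normc (ell2_inner S (e t)) ^+ 2 <= b * ell2_norm S ^+ 2.
  rewrite -lee_fin; apply: le_trans (bessel _ eS); apply: esum_ge.
  by exists [set` s] => //; rewrite fsbig_finite//= set_fsetK sumEFin.
have : 2 * ell2_norm S ^+ 2 <= b * (\sum_(t <- s) Normc.normc (c t) ^+ 2)
    + b^-1 * (b * ell2_norm S ^+ 2).
  apply: le_trans (_ : _ <= b * (\sum_(t <- s) Normc.normc (c t) ^+ 2)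
    + b^-1 * \sum_(t <- s) Normc.normc (ell2_inner S (e t)) ^+ 2) _.
    rewrite {1}SE !mulr_sumr -big_split; apply: ler_sum => t _; exact: young.
  by rewrite lerD2l ler_pM2l ?invr_gt0.
by rewrite mulKf ?gt_eqF// mulr2n mulrDl mul1r lerD2r.
Qed.

(** The dual argument: take the coefficients c_t = <h, e_t> on a finite set, so
    that |c|^2 = <h, S>, and absorb the half of |c|^2 that comes from |S|^2. *)
Lemma bessel_of_synthesis_le :
  (forall (s : {fset T}) (c : T -> R[i]),
    ell2_norm (fun l => \sum_(t <- s) c t *: e t l) ^+ 2 <=
    b * \sum_(t <- s) Normc.normc (c t) ^+ 2) ->
  forall h, ell2 h ->
    (\esum_(t in [set: T]) (Normc.normc (ell2_inner h (e t)) ^+ 2)%:E <=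
     (b * ell2_norm h ^+ 2)%:E)%E.
Proof.
move=> synth h eh; apply: ge_ereal_sup => _ [X [finX _] <-].
rewrite fsbig_finite//= sumEFin lee_fin.
set s := fset_set X; pose c t := ell2_inner h (e t).
have eS : ell2 (fun l => \sum_(t <- s) c t *: e t l) by exact: ell2_sum.
have hS : complex.Re (ell2_inner h (fun l => \sum_(t <- s) c t *: e t l))
    = \sum_(t <- s) Normc.normc (c t) ^+ 2.
  rewrite ell2_inner_sum// Re_sum; apply: eq_bigr => t _.
  by rewrite mulrC mul_conjc.
have := Re_ell2_inner_le b_gt0 eh eS; rewrite hS => H.
have : 2 * (\sum_(t <- s) Normc.normc (c t) ^+ 2) <= b * ell2_norm h ^+ 2
    + b^-1 * (b * \sum_(t <- s) Normc.normc (c t) ^+ 2).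
  by apply: le_trans H _; rewrite lerD2l ler_pM2l ?invr_gt0.
by rewrite mulKf ?gt_eqF// mulr2n mulrDl mul1r lerD2r.
Qed.

End Bessel.

(** * Perturbation of the shifts of one sequence *)

Section Perturbation.
Variables (R : realType) (n N r : nat).
Hypotheses (N_gt0 : (0 < N)%N) (r_odd : odd r).
Notation L := (Lambda R N r).
Notation mu := (@lebesgue_measure R).
Implicit Types (f d : L -> 'M[R[i]]_n) (F D : R -> 'M[R[i]]_n).

Lemma is_fourier_ell2 f F : is_fourier f F -> ell2 f.
Proof.
move=> fF; have /is_fourierP[_ iF _] := fF.
rewrite /ell2; under eq_esum do rewrite -sqr_frob_norm.
by rewrite (parseval N_gt0 r_odd fF).
Qed.

Lemma ell2_norm_energy f F : is_fourier f F -> (ell2_norm f ^+ 2)%:E = energy N F.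
Proof.
by move=> fF; rewrite ell2_normE ?(parseval N_gt0 r_odd fF)//; exact: is_fourier_ell2 fF.
Qed.

(** A pointwise comparison of Fourier transforms is a comparison of norms, by
    Parseval. *)
Lemma ell2_norm_le f d F D (eps : R) : is_fourier f F -> is_fourier d D ->
  {ae mu, forall x, Omega R N x -> frob_norm (D x) <= eps * frob_norm (F x)} ->
  ell2_norm d ^+ 2 <= eps ^+ 2 * ell2_norm f ^+ 2.
Proof.
move=> fF dD DF; have [[mF _] _] := fF; have [[mD _] _] := dD.
rewrite -lee_fin [in leRHS]EFinM (ell2_norm_energy fF) (ell2_norm_energy dD).
have mO := @measurable_Omega R N.
rewrite -ge0_integralZl_EFin ?sqr_ge0//=; last 2 first.
- by move=> x _; rewrite lee_fin sqr_ge0.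
- exact: measurable_frob.
apply: ae_ge0_le_integral => //.
- by move=> x _; rewrite lee_fin sqr_ge0.
- exact: measurable_frob.
- by move=> x _; rewrite mule_ge0 ?lee_fin ?sqr_ge0.
- by apply: measurable_funeM; exact: measurable_frob.
apply: (@filterS _ _ (ae_filter_ringOfSetsType mu)) DF => x DF Ox.
rewrite -EFinM lee_fin -exprMn.
by rewrite ler_sqr ?nnegrE ?DF// ?frob_norm_ge0// (le_trans (frob_norm_ge0 (D x)))// DF.
Qed.

(** Both linear combinations have the same scalar multiplier on the Fourier side,
    so the pointwise comparison survives multiplication by it. *)
Lemma shift_sum_le f d F D (eps : R) (s : seq L) (c : L -> R[i]) :
  is_fourier f F -> is_fourier d D ->
  {ae mu, forall x, Omega R N x -> frob_norm (D x) <= eps * frob_norm (F x)} ->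
  ell2_norm (fun l' => \sum_(l <- s) c l *: displacement l d l') ^+ 2 <=
  eps ^+ 2 * ell2_norm (fun l' => \sum_(l <- s) c l *: displacement l f l') ^+ 2.
Proof.
move=> fF dD DF.
apply: ell2_norm_le (is_fourier_shift_sum N_gt0 s c fF) (is_fourier_shift_sum N_gt0 s c dD) _.
apply: (@filterS _ _ (ae_filter_ringOfSetsType mu)) DF => x DF Ox.
by rewrite !frob_normZ mulrCA ler_wpM2l ?DF ?normc_ge0.
Qed.

Lemma bessel_perturbation f d F D (eps b : R) : 0 < eps -> 0 < b ->
  is_fourier f F -> is_fourier d D ->
  {ae mu, forall x, Omega R N x -> frob_norm (D x) <= eps * frob_norm (F x)} ->
  (forall h, ell2 h ->
    (\esum_(l in [set: L]) (Normc.normc (ell2_inner h (displacement l f)) ^+ 2)%:E <=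
     (b * ell2_norm h ^+ 2)%:E)%E) ->
  forall h, ell2 h ->
    (\esum_(l in [set: L]) (Normc.normc (ell2_inner h (displacement l d)) ^+ 2)%:E <=
     (eps ^+ 2 * b * ell2_norm h ^+ 2)%:E)%E.
Proof.
move=> e0 b0 fF dD DF bessel.
have disp_ell2 g G l : is_fourier g G -> ell2 (@displacement R n N r l g).
  by move=> gG; exact: is_fourier_ell2 (is_fourier_displacement N_gt0 l gG).
apply: bessel_of_synthesis_le; first by rewrite mulr_gt0 ?exprn_gt0.
  by move=> l; exact: disp_ell2 dD.
move=> s c; apply: le_trans (shift_sum_le s c fF dD DF) _.
rewrite -mulrA ler_pM2l ?exprn_gt0//.
by apply: synthesis_le_of_bessel => // l; exact: disp_ell2 fF.
Qed.

End Perturbation.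

(** * Perturbation of frame bounds *)

Section FrameArithmetic.
Variables (R : realType) (J : finType) (I : choiceType).
Implicit Types (u v : J -> I -> R[i]).

(** The squared norm of a family of analysis coefficients, possibly infinite. *)
Definition sqr_total u : \bar R :=
  (\sum_(j : J) \esum_(i in [set: I]) (Normc.normc (u j i) ^+ 2)%:E)%E.

Lemma sqr_totalD_le u v (d : R) : 0 < d ->
  (sqr_total (fun j i => (u j i + v j i)%R) <=
   (1 + d)%:E * sqr_total u + (1 + d^-1)%:E * sqr_total v)%E.
Proof.
move=> d0.
have d1 : 0 <= 1 + d by rewrite addr_ge0 ?ltW.
have d2 : 0 <= 1 + d^-1 by rewrite addr_ge0 ?invr_ge0 ?ltW.
have ge0 (w : R[i]) : (0 <= (Normc.normc w ^+ 2)%:E)%E by rewrite lee_fin sqr_ge0.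
have esum0 (w : J -> I -> R[i]) j : (0 <= \esum_(i in [set: I]) (Normc.normc (w j i) ^+ 2)%:E)%E.
  exact: esum_ge0.
rewrite /sqr_total !ge0_sume_distrr// -big_split/=.
apply: lee_sum => j _; rewrite -!esumZ; try by move=> *; exact: sqr_ge0.
all: rewrite // -esumD; try by move=> i _; rewrite lee_fin mulr_ge0 ?sqr_ge0.
apply: le_esum => i _; rewrite -EFinD lee_fin !normc_sqrE ReCD ImCD.
apply: le_trans (lerD (sqrD_le _ _ d0) (sqrD_le _ _ d0)) _.
by rewrite le_eqVlt; apply/orP; left; apply/eqP; ring.
Qed.

Lemma sqr_totalN u : sqr_total (fun j i => - u j i) = sqr_total u.
Proof. by apply: eq_bigr => j _; apply: eq_esum => i _; rewrite normcN. Qed.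

(** With norms in the space of coefficient families this reads
    |u| - |v| <= |u + v| for the lower bound and
    |u + v|^2 <= 2 |u|^2 + 2 |v|^2 for the upper one. *)
Lemma frame_bounds_perturbation u v (a b M H : R) :
  0 < M -> M < a -> 0 <= H ->
  ((a * H)%:E <= sqr_total u <= (b * H)%:E)%E ->
  (sqr_total v <= (M * H)%:E)%E ->
  (((Num.sqrt a - Num.sqrt M) ^+ 2 * H)%:E <=
   sqr_total (fun j i => (u j i + v j i)%R) <= ((2 * M + 2 * b) * H)%:E)%E.
Proof.
move=> M0 Ma H0 /andP[au ub] vM; apply/andP; split; last first.
  apply: le_trans (sqr_totalD_le u v ltr01) _; rewrite invr1.
  have -> : (2 * M + 2 * b) * H = (1 + 1) * (b * H) + (1 + 1) * (M * H) by ring.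
  rewrite (EFinD ((1 + 1) * _)).
  by apply: leeD; rewrite (EFinM (1 + 1)) lee_pmul2l ?lte_fin ?addr_gt0.
have sM : 0 < Num.sqrt M by rewrite sqrtr_gt0.
have sa : Num.sqrt M < Num.sqrt a by rewrite ltr_sqrt// (lt_trans M0).
set s := Num.sqrt M in sM sa *; set t := Num.sqrt a in sa *.
have ME : M = s ^+ 2 by rewrite sqr_sqrtr// ltW.
have aE : a = t ^+ 2 by rewrite sqr_sqrtr// ltW// (lt_trans M0).
have ts0 : 0 < t - s by rewrite subr_gt0.
have t0 : 0 < t by exact: lt_trans sa.
(* u = (u + v) - v is estimated with the weight for which the resulting lower
   bound is largest, namely exactly (t - s)^2 H. *)
have d0 : 0 < s / (t - s) by rewrite divr_gt0.
set z := sqr_total _.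
have z0 : (0 <= z)%E.
  by apply: sume_ge0 => j _; apply: esum_ge0 => i _; rewrite lee_fin sqr_ge0.
have : ((a * H)%:E <= (1 + s / (t - s))%:E * z + (1 + (s / (t - s))^-1)%:E * (M * H)%:E)%E.
  apply: le_trans au _.
  have -> : sqr_total u = sqr_total (fun j i => (u j i + v j i) + - v j i).
    by apply: eq_bigr => j _; apply: eq_esum => i _; rewrite addrK.
  apply: le_trans (sqr_totalD_le _ _ d0) _; rewrite sqr_totalN leeD2l//.
  by rewrite lee_pmul2l// lte_fin addr_gt0 ?invr_gt0.
have -> : 1 + s / (t - s) = t / (t - s) by field; rewrite gt_eqF.
have -> : 1 + (s / (t - s))^-1 = t / s by field; rewrite !gt_eqF.
case: z z0 => [z||]//; rewrite ?leey//.
rewrite !lee_fin => z0; rewrite ME aE.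
have -> : t / s * (s ^+ 2 * H) = t * s * H by field; rewrite gt_eqF.
rewrite -lerBlDr => E.
have : (t - s) / t * (t ^+ 2 * H - t * s * H) <= (t - s) / t * (t / (t - s) * z).
  by rewrite ler_pM2l ?divr_gt0.
have -> : (t - s) / t * (t ^+ 2 * H - t * s * H) = (t - s) ^+ 2 * H by field; rewrite gt_eqF.
by have -> : (t - s) / t * (t / (t - s) * z) = z by field; rewrite !gt_eqF.
Qed.

End FrameArithmetic.

Lemma ell2_norm_gt0 (R : realType) (n N r : nat) (f : Lambda R N r -> 'M[R[i]]_n) :
  ell2 f -> f <> (fun=> 0) -> 0 < ell2_norm f ^+ 2.
Proof.
move=> ef f0; rewrite lt0r sqr_ge0 andbT; apply/eqP => norm0.
have := ell2_normE ef; rewrite norm0 => E; apply: f0; apply/funext => l; apply: frob_norm_eq0.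
apply/eqP; rewrite -sqrf_eq0 eq_le sqr_ge0 andbT -lee_fin E.
by apply: esum_ge; exists [set l]; rewrite ?fsbig_set1.
Qed.

Unset Implicit Arguments.

Theorem theorem3p3 (R : realType) (n N r p : nat)
  (n_gt0 : (0 < n)%N) (N_gt0 : (0 < N)%N)
  (r_odd : odd r) (r_coprime : coprime r N) (r_bounds : (1 <= r <= 2 * N - 1)%N)
  (p_gt0 : (0 < p)%N)
  (f g : 'I_p -> Lambda R N r -> 'M[R[i]]_n)
  (F G : 'I_p -> R -> 'M[R[i]]_n)
  (a0 b0 eps : R)
  (f_frame : DFNS f a0 b0)
  (g_ell2 : forall j, ell2 (g j))
  (F_fourier : forall j, is_fourier (f j) (F j))
  (G_fourier : forall j, is_fourier (g j) (G j))
  (eps_gt0 : 0 < eps)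
  (eps_small :
    eps ^+ 2 < a0 / (2 ^+ (p - 1) * (N%:R + b0) ^+ 2 * n%:R ^+ 2))
  (close : forall j, {ae @lebesgue_measure R, forall x, Omega R N x ->
    F j x != 0 /\ frob_norm (G j x - F j x) / frob_norm (F j x) <= eps}) :
  DFNS g
    ((Num.sqrt a0
      - Num.sqrt (2 ^+ (p - 1) * eps ^+ 2 * (N%:R + b0) ^+ 2 * n%:R ^+ 2)) ^+ 2)
    (2 ^+ p * eps ^+ 2 * (N%:R + b0) ^+ 2 * n%:R ^+ 2 + 2 * b0).
Proof.
have [f_ell2 a0_gt0 b0_gt0 f_bounds] := f_frame.
set M := 2 ^+ (p - 1) * eps ^+ 2 * _ * _.
have MpE : 2 ^+ p * eps ^+ 2 * (N%:R + b0) ^+ 2 * n%:R ^+ 2 = 2 * M.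
  by rewrite -{1}(subnK p_gt0) exprD expr1 /M; ring.
have Nb_ge : b0 <= (N%:R + b0) ^+ 2.
  have N1 : 1 <= N%:R :> R by rewrite ler1n.
  nra.
have n1 : 1 <= n%:R :> R by rewrite ler1n.
have p_le : p%:R <= 2 ^+ (p - 1) :> R.
  by rewrite -natrX ler_nat -[leqLHS](subnK p_gt0) addn1 ltn_expl.
have Nb_gt0 : 0 < N%:R + b0 by rewrite ltr_wpDl.
have den_gt0 : 0 < 2 ^+ (p - 1) * (N%:R + b0) ^+ 2 * n%:R ^+ 2 :> R.
  by rewrite !mulr_gt0 ?exprn_gt0 ?ltr0n.
have M_gt0 : 0 < M by rewrite !mulr_gt0 ?exprn_gt0 ?ltr0n.
have M_lt : M < a0.
  move: eps_small; rewrite ltr_pdivlMr// => /(le_lt_trans _); apply.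
  by rewrite le_eqVlt; apply/orP; left; apply/eqP; rewrite /M; ring.
have M_ge : p%:R * (eps ^+ 2 * b0) <= M.
  have -> : M = 2 ^+ (p - 1) * (eps ^+ 2 * ((N%:R + b0) ^+ 2 * n%:R ^+ 2)).
    by rewrite /M; ring.
  apply: ler_pM => //; first by rewrite mulr_ge0 ?sqr_ge0// ltW.
  rewrite ler_pM2l ?exprn_gt0//; apply: le_trans Nb_ge _.
  by rewrite ler_peMr ?sqr_ge0// expr_ge1// ltW.
pose d j l := g j l - f j l.
have d_fourier j : is_fourier (d j) (fun x => G j x - F j x).
  exact: is_fourierB.
have d_ell2 j : ell2 (d j) by exact: is_fourier_ell2 (d_fourier j).
have dF j : {ae @lebesgue_measure R, forall x, Omega R N x ->
    frob_norm (G j x - F j x) <= eps * frob_norm (F j x)}.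
  apply: (@filterS _ _ (ae_filter_ringOfSetsType _)) (close j) => x H Ox.
  have [Fx0] := H Ox; rewrite ler_pdivrMr// lt0r frob_norm_ge0 andbT.
  by apply: contra Fx0 => /eqP/frob_norm_eq0 ->.
have d_bessel j := bessel_perturbation N_gt0 r_odd eps_gt0 b0_gt0
  (F_fourier j) (d_fourier j) (dF j).
have f_bessel j h : ell2 h ->
    (\esum_(l in [set: Lambda R N r])
      (Normc.normc (ell2_inner h (displacement l (f j))) ^+ 2)%:E
     <= (b0 * ell2_norm h ^+ 2)%:E)%E.
  move=> eh; have /andP[_] := f_bounds h eh; apply: le_trans.
  rewrite (bigD1 j)//= leeDl// sume_ge0// => k _; apply: esum_ge0 => l _.
  by rewrite lee_fin sqr_ge0.
(* The frame inequality at the nonzero vector f_0 gives a0 <= b0. *)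
have eps_lt1 : eps ^+ 2 < 1.
  pose j0 := Ordinal p_gt0; have [ef f0] := f_ell2 j0.
  have /andP[lo up] := f_bounds _ ef; have := le_trans lo up.
  rewrite lee_fin ler_pM2r ?ell2_norm_gt0// => ab.
  have : eps ^+ 2 * b0 < b0.
    apply: le_lt_trans (lt_le_trans M_lt ab); apply: le_trans M_ge.
    by rewrite ler_peMl ?ler1n// mulr_ge0 ?sqr_ge0 ?ltW.
  by rewrite gtr_pMl.
split.
- move=> j; split=> // g0.
  (* Here d j = - f j, so the pointwise estimate bounds f j by itself. *)
  have [ef f0] := f_ell2 j.
  have := ell2_norm_le N_gt0 r_odd (F_fourier j) (d_fourier j) (dF j).
  rewrite (_ : ell2_norm (d j) = ell2_norm (f j)).
    by rewrite leNgt gtr_pMl ?eps_lt1// ell2_norm_gt0.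
  apply/eqP; rewrite -(@eqrXn2 _ 2) ?sqrtr_ge0//; apply/eqP/EFin_inj.
  rewrite !ell2_normE//; apply: eq_esum => l _.
  by rewrite /d g0 sub0r frob_normN.
- by rewrite exprn_gt0// subr_gt0 ltr_sqrt.
- by rewrite MpE addr_gt0 ?[0 < 2 * _]mulr_gt0.
move=> h eh; rewrite MpE.
have := @frame_bounds_perturbation R 'I_p (Lambda R N r)
  (fun j l => ell2_inner h (displacement l (f j)))
  (fun j l => ell2_inner h (displacement l (d j)))
  a0 b0 M (ell2_norm h ^+ 2) M_gt0 M_lt (sqr_ge0 _) (f_bounds h eh).
have sum_d : (sqr_total (fun j l => ell2_inner h (displacement l (d j)))
    <= (M * ell2_norm h ^+ 2)%:E)%E.
  apply: (@le_trans _ _ (\sum_(j < p) (eps ^+ 2 * b0 * ell2_norm h ^+ 2)%:E)%E).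
    by apply: lee_sum => j _; exact: (d_bessel j (f_bessel j)) h eh.
  rewrite sumEFin lee_fin sumr_const card_ord -mulr_natl.
  by rewrite (mulrA p%:R) ler_wpM2r ?sqr_ge0.
move=> /(_ sum_d).
rewrite [sqr_total _](_ : _ = (\sum_(j < p) \esum_(l in [set: Lambda R N r])
  (Normc.normc (ell2_inner h (displacement l (g j))) ^+ 2)%:E)%E)//.
apply: eq_bigr => j _; apply: eq_esum => l _.
rewrite -ell2_innerD//; last 2 first.
- exact: is_fourier_ell2 (is_fourier_displacement N_gt0 l (F_fourier j)).
- exact: is_fourier_ell2 (is_fourier_displacement N_gt0 l (d_fourier j)).
congr (Normc.normc (ell2_inner h _) ^+ 2)%:E; apply/funext => l'.
by rewrite /displacement /d addrC subrK.
Qed.
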